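(* Assume the location-scale assumption holds with standardized variable $\xi$, and that the losses $\ell(z,\eta)$ have an unbounded right tail (i.e. $\mathbb{P}(\xi\ge y)>0$ for every $y\in\mathbb{R}$). Then $$\rho_{\mathbb{P}}(\ell(z,\eta))-\mathbb{E}\big[\rho_{\hat{\mathbb{P}}_N}(\ell(z,\eta))\big]=\omega\Big(\sqrt{\mathrm{Var}(\ell(z,\eta))}\Big).$$
   Context: Fix a risk aversion parameter $\alpha>0$ and an integer $N\ge 1$. $\mathcal{Z}\subseteq\mathbb{R}^d$ is a set of decisions, $\eta$ is a random vector with law $\mathbb{P}$, and $\ell(z,\eta)$ is a real random loss for each $z\in\mathcal{Z}$. The entropic risk is $\rho_{\mathbb{P}}(X)=\frac1\alpha\log\mathbb{E}_{\mathbb{P}}[\exp(\alpha X)]\in(-\infty,+\infty]$. Given i.i.d. samples $\hat\eta_1,\dots,\hat\eta_N$ from $\mathbb{P}$ with empirical distribution $\hat{\mathbb{P}}_N$, the empirical entropic risk is $\rho_{\hat{\mathbb{P}}_N}(\ell(z,\eta))=\frac1\alpha\log\big(\frac1N\sum_{i=1}^N\exp(\alpha\ell(z,\hat\eta_i))\big)$; the expectation $\mathbb{E}$ in the claim is over the samples. Location-scale assumption: there are a fixed real random variable $\xi$ with $\mathbb{E}[\xi]=0$, $\mathbb{E}[\xi^2]=1$ and a set $\mathcal{A}\subset\mathbb{R}\times\mathbb{R}_+$ such that the set of distributions of $\{\ell(z,\eta):z\in\mathcal{Z}\}$ equals the set of distributions of $\{\mu+\sigma\xi:(\mu,\sigma)\in\mathcal{A}\}$.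 Asymptotic notation: $\alpha$, $N$ and the law of $\xi$ are fixed, and quantities are considered as $\sigma=\sqrt{\mathrm{Var}(\ell(z,\eta))}$ varies. $f=\omega(g(\sigma))$ means: for every $c>0$ there is $\bar\sigma>0$ such that $c\,g(\sigma)\le f$ whenever $\sigma\ge\bar\sigma$. *)

(* Defs.v *)
(* MathComp-Analysis *)
From HB Require Import structures.
From mathcomp Require Import all_boot all_order all_algebra.
From mathcomp Require Import all_classical all_reals all_analysis.

Set Implicit Arguments.
Unset Strict Implicit.
Unset Printing Implicit Defensive.

Import Order.TTheory GRing.Theory Num.Theory.
Import numFieldNormedType.Exports.

Local Open Scope classical_set_scope.
Local Open Scope ring_scope.

(* [lne +oo = +oo], so the risk is +oo when the exponential moment is. *)
Definition entropic_risk (R : realType) (d : measure_display)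
    (T : measurableType d) (alpha : R) (P : probability T R) (X : T -> R) :
    \bar R :=
  ((alpha^-1)%:E * lne 'E_P[fun w => expR (alpha * X w)])%E.

Definition empirical_entropic_risk (R : realType) (N : nat) (alpha : R)
    (x : 'I_N -> R) : R :=
  alpha^-1 * ln (N%:R^-1 * \sum_(i < N) expR (alpha * x i)).

Definition std_dev (R : realType) (d : measure_display) (T : measurableType d)
    (P : probability T R) (X : T -> R) : \bar R :=
  (sqrte 'V_P[X])%E.

(* Laws are compared on measurable sets only: [distribution] is also defined,
   without any meaning, on non-measurable ones. *)
Definition has_law (R : realType) (d d' : measure_display)
    (T : measurableType d) (T' : measurableType d')
    (P : probability T R) (X : T -> T') (nu : probability T' R) : Prop :=
  forall B : set T', measurable B -> nu B = P (X @^-1` B).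

Definition mutually_independent (R : realType) (d d' : measure_display)
    (T : measurableType d) (T' : measurableType d') (N : nat)
    (P : probability T R) (X : 'I_N -> T -> T') : Prop :=
  forall (J : {set 'I_N}) (B : 'I_N -> set T'),
    (forall i, measurable (B i)) ->
    P (\bigcap_(i in [set` J]) (X i @^-1` B i)) =
      (\prod_(i in J) P (X i @^-1` B i))%E.

Definition iid_samples (R : realType) (d d' : measure_display)
    (S : measurableType d) (T' : measurableType d') (N : nat)
    (Q : probability S R) (etahat : 'I_N -> {RV Q >-> T'})
    (law : probability T' R) : Prop :=
  (forall i, has_law Q (etahat i) law) /\
  mutually_independent Q (fun i => etahat i : S -> T').

(* [L z] is the loss of decision [z], a random variable under [P]. *)
Definition location_scale (R : realType) (d d' : measure_display)
    (T : measurableType d) (T' : measurableType d') (D : Type) (Z : set D)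
    (P : probability T R) (L : D -> T -> R)
    (PX : probability T' R) (xi : {RV PX >-> R}) : Prop :=
  [/\ ('E_PX[xi] = 0)%E,
      ('E_PX[fun w => (xi w ^+ 2)%R] = 1)%E &
      exists A : set (R * R),
        (forall p, A p -> 0 <= p.2) /\
        [set nu : probability R R | exists2 z, Z z & has_law P (L z) nu] =
        [set nu : probability R R |
          exists2 p, A p & has_law PX (fun w => p.1 + p.2 * xi w) nu]].

Definition little_omega (R : realType) (D : Type) (Z : set D)
    (sigma : D -> \bar R) (g : \bar R -> \bar R) (f : D -> \bar R) : Prop :=
  forall c : R, 0 < c -> exists2 sbar : R, 0 < sbar &
    forall z, Z z -> (sbar%:E <= sigma z)%E -> (c%:E * g (sigma z) <= f z)%E.

(* Main.v *)
Require Import Defs.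
From HB Require Import structures.
From mathcomp Require Import all_boot all_order all_algebra.
From mathcomp Require Import all_classical all_reals all_analysis.
From mathcomp Require Import measurable_realfun lra.

Set Implicit Arguments.
Unset Strict Implicit.
Unset Printing Implicit Defensive.

Import Order.TTheory GRing.Theory Num.Theory.
Import numFieldNormedType.Exports.

Local Open Scope classical_set_scope.
Local Open Scope ring_scope.

(** The empirical entropic risk never exceeds the largest observation, whereas
    the true entropic risk sees arbitrarily remote parts of the tail.

    Let the loss have the law of [mu + sigma * xi]. The empirical risk of a
    sample [X_1, ..., X_N] is at most [mu + \sum_i `|X_i - mu|], and since
    [E `|xi| <= 1] its expectation is at most [mu + N * sigma]
    ([expectation_empirical_entropic_risk_le], [expectation_dev_le]). On the
    other side, for every level [y],
    [E exp (alpha * (mu + sigma * xi))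
       >= exp (alpha * (mu + sigma * y)) * p], where [p = P (xi >= y)],
    so the entropic risk is at least
    [mu + sigma * y + alpha^-1 * ln p] ([entropic_risk_ge], [tail_affine]).
    The unbounded tail makes [p > 0] for every [y], and the gap is at least
    [sigma * (y - N) + alpha^-1 * ln p]. With [y = N + c + 1] this is
    [c * sigma] plus [sigma + alpha^-1 * ln p], whose last term does not
    depend on [sigma]; hence the gap exceeds [c * sigma] for large [sigma]. *)

(** * Laws and integrals *)

Lemma superlevelE (R : realType) (T : Type) (X : T -> R) (a : R) :
  [set w | a <= X w] = X @^-1` `[a, +oo[%classic.
Proof. by apply/seteqP; split => w /=; rewrite in_itv/= andbT. Qed.

Lemma measurable_superlevel (R : realType) (d : measure_display)
    (T : measurableType d) (X : T -> R) (a : R) :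
  measurable_fun [set: T] X -> measurable [set w | a <= X w].
Proof. by move=> mX; rewrite superlevelE -[X in measurable X]setTI; exact: mX. Qed.

(** The integral of a signed function is by definition the difference of the
    integrals of its positive and negative parts, and each of these depends on
    the law only, be it finite or not. *)
Lemma integral_law (R : realType) (d d' : measure_display)
    (T : measurableType d) (T' : measurableType d')
    (P : probability T R) (X : T -> T') (nu : probability T' R)
    (f : T' -> \bar R) :
  measurable_fun [set: T] X -> measurable_fun [set: T'] f ->
  has_law P X nu -> (\int[nu]_y f y = \int[P]_w f (X w))%E.
Proof.
move=> mX mf lawX.
pose Xm := isMeasurableFun.Build _ _ _ _ _ mX.
pose X' : {mfun T >-> T'} := HB.pack X Xm.
have ge0_transport (g : T' -> \bar R) : measurable_fun [set: T'] g ->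
    (forall y, 0 <= g y)%E -> (\int[nu]_y g y = \int[P]_w g (X w))%E.
  move=> mg g0; rewrite -(@ge0_integral_distribution _ _ _ _ _ P X')//.
  by apply: eq_measure_integral => B mB _; exact: lawX.
rewrite [LHS]integralE [RHS]integralE; congr (_ - _)%E.
- rewrite ge0_transport//; last exact: measurable_funepos.
  by apply: eq_integral => w _; rewrite !funeposE.
- rewrite ge0_transport//; last exact: measurable_funeneg.
  by apply: eq_integral => w _; rewrite !funenegE.
Qed.

(** * The empirical entropic risk *)

(** The empirical risk is an exponential mean of the sample, so it lies between
    the smallest and the largest observation; both are at distance from [mu]
    at most the sum of all the deviations. *)
Lemma dist_empirical_entropic_risk_le (R : realType) (N : nat) (alpha mu : R)
    (x : 'I_N -> R) : 0 < alpha -> (0 < N)%N ->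
  `|empirical_entropic_risk alpha x - mu| <= \sum_(i < N) `|x i - mu|.
Proof.
move=> alpha0 N0; set D := \sum_(i < N) _.
have N0R : 0 < N%:R :> R by rewrite ltr0n.
have dist_le i : `|x i - mu| <= D.
  by rewrite /D (bigD1 i)//= lerDl sumr_ge0.
have mean_cst (a : R) : N%:R^-1 * \sum_(i < N) a = a.
  by rewrite sumr_const card_ord -[a *+ N]mulr_natl mulKf// gt_eqF.
have mean_le (u v : 'I_N -> R) : (forall i, u i <= v i) ->
    N%:R^-1 * \sum_(i < N) u i <= N%:R^-1 * \sum_(i < N) v i.
  by move=> uv; rewrite ler_pM2l ?invr_gt0//; exact: ler_sum.
set E := N%:R^-1 * \sum_(i < N) expR (alpha * x i).
have upE : E <= expR (alpha * (mu + D)).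
  rewrite -[leRHS]mean_cst; apply: mean_le => i.
  rewrite ler_expR ler_pM2l//; have := dist_le i; rewrite ler_norml; lra.
have loE : expR (alpha * (mu - D)) <= E.
  rewrite -[leLHS]mean_cst; apply: mean_le => i.
  rewrite ler_expR ler_pM2l//; have := dist_le i; rewrite ler_norml; lra.
have E0 : 0 < E by exact: lt_le_trans (expR_gt0 _) loE.
have up : ln E <= alpha * (mu + D).
  by rewrite -[leRHS]expRK ler_ln// posrE expR_gt0.
have lo : alpha * (mu - D) <= ln E.
  by rewrite -[leLHS]expRK ler_ln// posrE expR_gt0.
rewrite /empirical_entropic_risk -/E ler_distl.
by rewrite ler_pdivlMl// lo ler_pdivrMl.
Qed.

(** The factor [N] comes from bounding the maximum of [N] deviations by their
    sum, so that the expectation splits into one mean deviation per sample. The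
    same bound makes the expectation a real number [e]: the difference of an
    infinite risk and [e] is then unambiguously infinite. *)
Lemma expectation_empirical_entropic_risk_le (R : realType) (N : nat)
    (alpha mu s : R) (d : measure_display) (S : measurableType d)
    (Q : probability S R) (X : 'I_N -> S -> R) :
  0 < alpha -> (0 < N)%N ->
  (forall i, measurable_fun [set: S] (X i)) ->
  (forall i, ('E_Q[fun w => `|X i w - mu|%R] <= s%:E)%E) ->
  exists2 e : R,
    ('E_Q[fun w => empirical_entropic_risk alpha (fun i => X i w)] = e%:E)%E &
    e <= mu + N%:R * s.
Proof.
move=> alpha0 N0 mX devX.
pose emp w := empirical_entropic_risk alpha (fun i => X i w).
have mdev i : measurable_fun [set: S] (fun w => `|X i w - mu|).
  by apply: measurableT_comp => //; exact: measurable_funB.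
have memp : measurable_fun [set: S] emp.
  apply: measurable_funM => //.
  apply: measurableT_comp; first exact: measurable_ln.
  apply: measurable_funM => //; apply: measurable_sum => i.
  by apply: measurableT_comp => //; exact: measurable_funM.
have intdev i : Q.-integrable [set: S] (fun w => (`|X i w - mu|)%:E).
  apply/integrableP; split; first exact/measurable_EFinP.
  apply: (@le_lt_trans _ _ s%:E); last by rewrite ltry.
  apply: le_trans (devX i); rewrite unlock.
  by under eq_integral do rewrite /= normr_id.
have intcst r : Q.-integrable [set: S] (fun=> r%:E).
  exact: finite_measure_integrable_cst.
pose bnd r w := (r%:E + \sum_(i < N) (`|X i w - mu|)%:E)%E.
have intsum : Q.-integrable [set: S]
    (fun w => \sum_(i < N) (`|X i w - mu|)%:E)%E by exact: integrable_sum.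
have intbnd r : Q.-integrable [set: S] (bnd r) by exact: integrableD.
have empd w := dist_empirical_entropic_risk_le mu (fun i => X i w) alpha0 N0.
have intemp : Q.-integrable [set: S] (EFin \o emp).
  apply: le_integrable (intbnd `|mu|) => //; first exact/measurable_EFinP.
  move=> w _; rewrite /bnd sumEFin -EFinD !abse_EFin lee_fin.
  have := empd w; rewrite -/(emp w) => h.
  rewrite [leRHS]ger0_norm ?addr_ge0 ?sumr_ge0//.
  have := ler_normD (emp w - mu) mu; rewrite subrK; lra.
have empfin : 'E_Q[emp]%E \is a fin_num.
  by rewrite unlock; exact: integrable_fin_num.
exists (fine 'E_Q[emp]%E); first by rewrite fineK.
rewrite -lee_fin fineK// unlock.
apply: (@le_trans _ _ (\int[Q]_w bnd mu w)%E).
  apply: le_integral => // w _; rewrite /bnd sumEFin -EFinD lee_fin.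
  have := empd w; rewrite -/(emp w) ler_norml; lra.
rewrite /bnd integralD//= integral_cst//= probability_setT mule1 EFinD leeD2l//.
rewrite integral_sum//.
apply: (@le_trans _ _ (\sum_(i < N) s%:E)%E).
  by apply: lee_sum => i _; have := devX i; rewrite unlock.
by rewrite sumEFin lee_fin sumr_const card_ord mulr_natl.
Qed.

(** * The entropic risk *)

(** The Markov inequality for [expR (alpha * X)], read as a lower bound on the
    exponential moment. *)
Lemma entropic_risk_ge (R : realType) (alpha a p : R) (d : measure_display)
    (T : measurableType d) (P : probability T R) (X : T -> R) :
  0 < alpha -> 0 < p -> measurable_fun [set: T] X ->
  (p%:E <= P [set w | (a <= X w)%R])%E ->
  ((a + alpha^-1 * ln p)%:E <= entropic_risk alpha P X)%E.
Proof.
move=> alpha0 p0 mX tail.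
have mA : measurable [set w | a <= X w] by exact: measurable_superlevel.
set A := [set w | _] in tail mA.
have expmom : ((expR (alpha * a) * p)%:E <= 'E_P[fun w => expR (alpha * X w)])%E.
  apply: (@le_trans _ _ (\int[P]_w ((expR (alpha * a))%:E * (\1_A w)%:E))%E).
    rewrite ge0_integralZl//; last exact/measurable_EFinP.
    by rewrite integral_indic// setIT EFinM lee_pmul2l// lte_fin expR_gt0.
  rewrite unlock; apply: ge0_le_integral => //.
  - apply: measurable_funeM; exact/measurable_EFinP.
  - apply/measurable_EFinP; apply: measurableT_comp => //.
    exact: measurable_funM.
  - move=> w _; rewrite -EFinM lee_fin indicE.
    have [|_] := boolP (w \in A); last by rewrite mulr0 expR_ge0.
    by rewrite inE /A/= => aX; rewrite mulr1 ler_expR ler_pM2l.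
have q0 : 0 < expR (alpha * a) * p by rewrite mulr_gt0 ?expR_gt0.
have -> : a + alpha^-1 * ln p = alpha^-1 * ln (expR (alpha * a) * p).
  by rewrite lnM ?posrE ?expR_gt0// expRK mulrDr mulKf// gt_eqF.
rewrite EFinM /entropic_risk lee_pmul2l ?lte_fin ?invr_gt0//.
have q0E : (0%:E <= (expR (alpha * a) * p)%:E)%E by rewrite lee_fin ltW.
rewrite -lne_EFin// lee_lne// in_itv/= leey andbT//.
exact: le_trans expmom.
Qed.

(** * Location-scale laws *)

(** From [2 * `|x| <= x ^+ 2 + 1]. *)
Lemma expectation_norm_le1 (R : realType) (d : measure_display)
    (T : measurableType d) (P : probability T R) (X : T -> R) :
  measurable_fun [set: T] X -> ('E_P[fun w => (X w ^+ 2)%R] = 1)%E ->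
  ('E_P[fun w => `|X w|%R] <= 1)%E.
Proof.
move=> mX m2.
apply: (@le_trans _ _ (\int[P]_w ((2^-1)%:E * ((X w ^+ 2)%:E + 1)))%E).
  rewrite unlock; apply: ge0_le_integral => //.
  - by apply/measurable_EFinP; exact: measurableT_comp.
  - apply/measurable_EFinP; apply: measurable_funM => //.
    by apply: measurable_funD => //; exact: measurable_funX.
  - move=> w _; rewrite -EFinD -EFinM lee_fin -(real_normK (num_real (X w))).
    have := sqr_ge0 (`|X w| - 1); lra.
have mX2 : measurable_fun [set: T] (fun w => (X w ^+ 2)%:E).
  by apply/measurable_EFinP; exact: measurable_funX.
rewrite ge0_integralZl//; last first.
- by move=> w _; rewrite adde_ge0// lee_fin sqr_ge0.
- by apply: emeasurable_funD.
rewrite ge0_integralD//; last by move=> w _; rewrite lee_fin sqr_ge0.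
move: m2; rewrite unlock => ->.
rewrite integral_cst//= probability_setT mule1 -EFinD -EFinM lee_fin; lra.
Qed.

(** [X] has the law of [mu + sigma * xi]. The two variables live on unrelated
    spaces, so the law is passed through the common distribution [nu]. *)
Section affine_law.
Context {R : realType} {dX : measure_display} {OmegaX : measurableType dX}.
Variables (PX : probability OmegaX R) (xi : OmegaX -> R) (mu sigma : R).
Hypothesis mxi : measurable_fun [set: OmegaX] xi.
Hypothesis mean0 : ('E_PX[xi] = 0)%E.
Hypothesis var1 : ('E_PX[fun w => (xi w ^+ 2)%R] = 1)%E.
Hypothesis sigma0 : 0 <= sigma.
Context {d : measure_display} {T : measurableType d}.
Variables (P : probability T R) (X : T -> R) (nu : probability R R).
Hypothesis mX : measurable_fun [set: T] X.
Hypothesis lawX : has_law P X nu.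
Hypothesis lawxi : has_law PX (fun w => mu + sigma * xi w) nu.

Let maff : measurable_fun [set: OmegaX] (fun w => mu + sigma * xi w).
Proof. by apply: measurable_funD => //; exact: measurable_funM. Qed.

Lemma expectation_affine (f : R -> R) : measurable_fun [set: R] f ->
  ('E_P[fun w => f (X w)] = 'E_PX[fun w => f (mu + sigma * xi w)%R])%E.
Proof.
move=> mf; rewrite unlock.
have mEf : measurable_fun [set: R] (fun y => (f y)%:E) by exact/measurable_EFinP.
by rewrite -(integral_law mX mEf lawX) (integral_law maff mEf lawxi).
Qed.

Lemma tail_affine (y : R) :
  (PX [set w | y <= xi w]%R <= P [set w | (mu + sigma * y <= X w)%R])%E.
Proof.
rewrite [X in (_ <= P X)%E]superlevelE -lawX// lawxi// -superlevelE.
apply: le_measure; rewrite ?inE; try exact: measurable_superlevel.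
by move=> w /= yxi; rewrite lerD2l ler_wpM2l.
Qed.

(** Since [X - mu] has the law of [sigma * xi] and [E `|xi| <= 1], the constant
    in front of [sigma] is 1; the choice of the tail level in the final
    argument relies on this value. *)
Lemma expectation_dev_le : ('E_P[fun w => `|X w - mu|%R] <= sigma%:E)%E.
Proof.
rewrite (@expectation_affine (fun x => `|x - mu|)); last first.
  by apply: measurableT_comp => //; exact: measurable_funB.
rewrite unlock; under eq_integral do
  rewrite /= addrAC subrr add0r normrM (ger0_norm sigma0) EFinM.
rewrite ge0_integralZl//; last first.
  by apply/measurable_EFinP; exact: measurableT_comp.
rewrite -[leRHS]mule1; apply: lee_wpmul2l; first by rewrite lee_fin.
by have := expectation_norm_le1 mxi var1; rewrite unlock.
Qed.

Let intxi : PX.-integrable [set: OmegaX] (EFin \o xi).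
Proof.
apply/integrableP; split; first exact/measurable_EFinP.
apply: (@le_lt_trans _ _ 1%E); last by rewrite ltry.
by have := expectation_norm_le1 mxi var1; rewrite unlock.
Qed.

Lemma mean_affine : ('E_P[X] = mu%:E)%E.
Proof.
have -> : ('E_P[X] = 'E_PX[fun w => (mu + sigma * xi w)%R])%E.
  exact: (@expectation_affine id).
move: mean0; rewrite unlock => m0.
under eq_integral do rewrite EFinD EFinM.
rewrite integralD//; last 2 first.
- exact: finite_measure_integrable_cst.
- exact: integrableZl.
rewrite integralZl// m0 mule0 adde0.
by rewrite integral_cst//= probability_setT mule1.
Qed.

Lemma std_dev_affine : std_dev P X = sigma%:E.
Proof.
rewrite /std_dev /variance unlock mean_affine /=.
have -> : (X \- cst mu) * (X \- cst mu) = (fun w => (X w - mu) ^+ 2).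
  by apply/funext => w; rewrite expr2.
rewrite (@expectation_affine (fun x => (x - mu) ^+ 2)); last first.
  by apply: measurable_funX; exact: measurable_funB.
rewrite unlock; under eq_integral do
  rewrite /= addrAC subrr add0r exprMn EFinM.
rewrite ge0_integralZl//; first last.
- by rewrite lee_fin sqr_ge0.
- by move=> w _; rewrite lee_fin sqr_ge0.
- by apply/measurable_EFinP; exact: measurable_funX.
move: var1; rewrite unlock => ->.
by rewrite mule1 /= sqrtr_sqr ger0_norm.
Qed.

End affine_law.

(** * The gap *)

Theorem proposition2 (R : realType) (alpha : R) (N : nat)
    (halpha : 0 < alpha) (hN : (1 <= N)%N)
    (n m : nat) (Z : set 'rV[R]_n)
    (dO : measure_display) (Omega : measurableType dO)
    (Pr : probability Omega R) (eta : {RV Pr >-> m.-tuple R})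
    (ell : 'rV[R]_n -> m.-tuple R -> R)
    (mell : forall z, Z z -> measurable_fun [set: m.-tuple R] (ell z))
    (dS : measure_display) (S : measurableType dS) (Q : probability S R)
    (etahat : 'I_N -> {RV Q >-> m.-tuple R})
    (hiid : iid_samples etahat (distribution Pr eta))
    (dX : measure_display) (OmegaX : measurableType dX)
    (PX : probability OmegaX R) (xi : {RV PX >-> R})
    (hls : location_scale Z Pr (fun z w => ell z (eta w)) xi)
    (htail : forall y : R, (0 < PX [set w | y <= xi w]%R)%E) :
  little_omega Z
    (fun z => std_dev Pr (fun w => ell z (eta w)))
    (fun s => s)
    (fun z => entropic_risk alpha Pr (fun w => ell z (eta w)) -
              'E_Q[fun s => empirical_entropic_risk alpha
                              (fun i => ell z (etahat i s))])%E.
Proof.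
case: hls => mean0 var1 [A [A0 lawsE]].
have mxi : measurable_fun [set: OmegaX] (xi : OmegaX -> R).
  exact: measurable_funPT.
have meta : measurable_fun [set: Omega] (eta : Omega -> m.-tuple R).
  exact: measurable_funPT.
have metahat i : measurable_fun [set: S] (etahat i : S -> m.-tuple R).
  exact: measurable_funPT.
(* [N] pays for the empirical risk, [c] is the required rate, and the extra 1
   leaves a term [sigma] that absorbs [alpha^-1 * ln p]. *)
move=> c c0; pose y : R := N%:R + c + 1.
have pfin : PX [set w | y <= xi w]%R \is a fin_num.
  by apply: fin_num_measure; exact: measurable_superlevel.
pose p := fine (PX [set w | y <= xi w]%R).
have p0 : 0 < p by rewrite -lte_fin fineK.
exists (1 + `|alpha^-1 * ln p|); first by rewrite ltr_pwDl.
move=> z Zz.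
have mL : measurable_fun [set: Omega] (fun w => ell z (eta w)).
  by apply: measurableT_comp meta; exact: mell.
have mLhat i : measurable_fun [set: S] (fun s => ell z (etahat i s)).
  by apply: measurableT_comp (metahat i); exact: mell.
pose Lm := isMeasurableFun.Build _ _ _ _ _ mL.
pose L : {mfun Omega >-> R} := HB.pack (fun w => ell z (eta w)) Lm.
pose nu : probability R R := distribution Pr L.
have lawL : has_law Pr (fun w => ell z (eta w)) nu by [].
have lawLhat i : has_law Q (fun s => ell z (etahat i s)) nu.
  move=> B mB; have [lawhat _] := hiid.
  have mC : measurable (ell z @^-1` B).
    by rewrite -[X in measurable X]setTI; exact: mell.
  by have := lawhat i _ mC.
have : [set nu : probability R R |
    exists2 z, Z z & has_law Pr (fun w => ell z (eta w)) nu] nu by exists z.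
rewrite lawsE => -[[mu sigma] /A0/= sigma0 /= lawxi].
rewrite (std_dev_affine mxi mean0 var1 sigma0 mL lawL lawxi) lee_fin => sbar.
have [i|e -> e_le] := @expectation_empirical_entropic_risk_le R N alpha mu sigma
  dS S Q (fun i s => ell z (etahat i s)) halpha hN mLhat.
  exact: (expectation_dev_le mxi var1 sigma0 (mLhat i) (lawLhat i) lawxi).
have := entropic_risk_ge halpha p0 mL (a := mu + sigma * y).
rewrite fineK// => /(_ _ (tail_affine mxi sigma0 lawL lawxi y)) rho_ge.
apply: le_trans (leeB rho_ge (lexx e%:E)).
rewrite -EFinB -EFinM lee_fin.
have := ler_norm (- (alpha^-1 * ln p)); rewrite normrN.
rewrite /y !mulrDr mulr1; move: e_le sbar; rewrite (mulrC N%:R) (mulrC c).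
lra.
Qed.
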